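(* Assume that $F$ is $\mu$-strongly convex with $\mu>0$, that $f(\cdot;\xi)$ is $L$-smooth for every realization of $\xi$, and that $f(\cdot;\xi)$ is convex for every realization of $\xi$. Let $w_*=\arg\min_w F(w)$ and $N=2\mathbb{E}[\|\nabla f(w_*;\xi)\|^2]$, with $0<N<\infty$. Let $\alpha=2$ and $E=\frac{2\alpha L}{\mu}$. Consider the SGD iteration $w_{t+1}=w_t-\eta_t\nabla f(w_t;\xi_t)$, $t\ge0$, with stepsizes $\eta_t=\frac{\alpha}{\mu(t+E)}\le\eta_0=\frac{1}{2L}$. Then $$\mathbb{E}[\|w_t-w_*\|^2]\le\frac{4\alpha^2N}{\mu^2}\,\frac{1}{t-T+E}$$ for all $$t\ge T=\frac{4L}{\mu}\max\Big\{\frac{L\mu}{N}\|w_0-w_*\|^2,\,1\Big\}-\frac{4L}{\mu}.$$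
   Context: $\xi$ is a random variable, $f(\cdot;\xi):\mathbb{R}^d\to\mathbb{R}$ is differentiable for every realization of $\xi$, $F(w)=\mathbb{E}[f(w;\xi)]$, and $\mathbb{E}[\nabla f(w;\xi)]=\nabla F(w)$ for every fixed $w\in\mathbb{R}^d$. The norm is Euclidean. $\mu$-strong convexity of $F$: $F(w)-F(w')\ge\langle\nabla F(w'),w-w'\rangle+\frac{\mu}{2}\|w-w'\|^2$ for all $w,w'\in\mathbb{R}^d$. $L$-smoothness of $f(\cdot;\xi)$ (with $L>0$ independent of the realization): $\|\nabla f(w;\xi)-\nabla f(w';\xi)\|\le L\|w-w'\|$ for all $w,w'$. Convexity of $f(\cdot;\xi)$: $f(w;\xi)-f(w';\xi)\ge\langle\nabla f(w';\xi),w-w'\rangle$ for all $w,w'$. In the SGD method, $w_0\in\mathbb{R}^d$ is a given (deterministic) initial point and $\xi_0,\xi_1,\dots$ are i.i.d. copies of $\xi$. *)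

(* Defs.v *)
From HB Require Import structures.
From mathcomp Require Import all_boot all_order all_algebra finmap.
From mathcomp Require Import all_classical all_reals all_analysis.

Set Implicit Arguments.
Unset Strict Implicit.
Unset Printing Implicit Defensive.

Import Order.TTheory GRing.Theory Num.Theory.
Import numFieldNormedType.Exports.

Local Open Scope classical_set_scope.
Local Open Scope ring_scope.

Section Euclidean.
Context {R : realType} {n : nat}.
Implicit Types (u v w : 'rV[R]_n) (F : 'rV[R]_n -> R).

Definition dotp u v : R := \sum_(i < n) u 0 i * v 0 i.

(* The norm that the library puts on 'rV[R]_n is the sup norm. It induces the
   same topology, hence the same notion of differentiability. *)
Definition enorm u : R := Num.sqrt (dotp u u).

Definition grad F w : 'rV[R]_n := \row_(i < n) 'D_(delta_mx 0 i) F w.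

Definition strongly_convex (mu : R) F : Prop :=
  forall w w', F w - F w' >=
    dotp (grad F w') (w - w') + mu / 2 * enorm (w - w') ^+ 2.

Definition smooth (L : R) F : Prop :=
  forall w w', enorm (grad F w - grad F w') <= L * enorm (w - w').

Definition grad_convex F : Prop :=
  forall w w', F w - F w' >= dotp (grad F w') (w - w').

Definition is_argmin F w : Prop := forall w', F w <= F w'.

End Euclidean.

Section Probability.
Context {R : realType} {dT dX : measure_display}
  {T : measurableType dT} {X : measurableType dX} (P : probability T R).

Definition has_mean (Y : T -> R) (m : R) : Prop :=
  P.-integrable setT (EFin \o Y) /\ ('E_P[Y] = m%:E)%E.

Definition mutually_independent (xi : nat -> {RV P >-> X}) : Prop :=
  forall (J : {fset nat}) (A : nat -> set X), (forall t, measurable (A t)) ->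
    P (\bigcap_(t in [set` J]) (xi t @^-1` A t)) =
    (\prod_(t <- J) P (xi t @^-1` A t))%E.

Definition same_distribution (xi xi' : {RV P >-> X}) : Prop :=
  forall A : set X, measurable A -> distribution P xi A = distribution P xi' A.

Definition iid_copies (xi : {RV P >-> X}) (xis : nat -> {RV P >-> X}) : Prop :=
  (forall t, same_distribution (xis t) xi) /\ mutually_independent xis.

End Probability.

Fixpoint sgd {R : realType} {n : nat} {T X : Type} (f : 'rV[R]_n -> X -> R)
    (w0 : 'rV[R]_n) (eta : nat -> R) (xis : nat -> T -> X) (t : nat) (om : T) :
    'rV[R]_n :=
  if t is s.+1 then
    let w := sgd f w0 eta xis s om in
    w - eta s *: grad (f ^~ (xis s om)) w
  else w0.

(* Main.v *)
Require Import Defs.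
From HB Require Import structures.
From mathcomp Require Import all_boot all_order all_algebra finmap.
From mathcomp Require Import all_classical all_reals all_analysis.
From mathcomp Require Import measurable_realfun ring lra.

Import Order.TTheory GRing.Theory Num.Theory.
Import numFieldNormedType.Exports.

Local Open Scope classical_set_scope.
Local Open Scope ring_scope.

(* Co-coercivity of the gradient of a smooth convex function, grad F wstar = 0
   and 2 L eta <= 1 give, for every fixed point v,
     E |v - eta grad f(v; xi) - wstar|^2 <= (1 - mu eta) |v - wstar|^2 + eta^2 N.
   The t-th iterate depends on xi_0, ..., xi_(t-1) only, hence is independent of
   xi_t, and Fubini turns this into the same bound with v replaced by the random
   iterate. With s = t + E it reads
     Y_(t+1) <= (1 - 2/s) Y_t + (4 N / mu^2) / s^2,
   so (s - 1) (s - 2) Y_t grows at most linearly in t. Strong convexity and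
   smoothness force mu <= L, that is E >= 4, which absorbs the lower-order terms. *)

Set Implicit Arguments.
Unset Strict Implicit.
Unset Printing Implicit Defensive.

(** * Smooth convex functions *)

Section InnerProduct.
Context {R : realType} {n : nat}.
Implicit Types (u v w : 'rV[R]_n).

Lemma dotpC u v : dotp u v = dotp v u.
Proof. by apply: eq_bigr => i _; rewrite mulrC. Qed.

Lemma dotpDl u v w : dotp (u + v) w = dotp u w + dotp v w.
Proof.
by rewrite /dotp -big_split; apply: eq_bigr => i _; rewrite mxE mulrDl.
Qed.

Lemma dotpZl a u v : dotp (a *: u) v = a * dotp u v.
Proof. by rewrite /dotp mulr_sumr; apply: eq_bigr => i _; rewrite mxE mulrA. Qed.

Lemma dotpNl u v : dotp (- u) v = - dotp u v.
Proof. by rewrite -scaleN1r dotpZl mulN1r. Qed.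

Lemma dotpDr u v w : dotp u (v + w) = dotp u v + dotp u w.
Proof. by rewrite dotpC dotpDl !(dotpC u). Qed.

Lemma dotpZr a u v : dotp u (a *: v) = a * dotp u v.
Proof. by rewrite dotpC dotpZl dotpC. Qed.

Lemma dotpNr u v : dotp u (- v) = - dotp u v.
Proof. by rewrite dotpC dotpNl dotpC. Qed.

Definition dotp_linear := (dotpDl, dotpDr, dotpNl, dotpNr, dotpZl, dotpZr).

Lemma dotp_ge0 u : 0 <= dotp u u.
Proof. by apply: sumr_ge0 => i _; rewrite -expr2 sqr_ge0. Qed.

Lemma coord_sqr_le_dotp u i : u 0 i ^+ 2 <= dotp u u.
Proof.
rewrite /dotp (bigD1 i) //= -expr2 lerDl.
by apply: sumr_ge0 => j _; rewrite -expr2 sqr_ge0.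
Qed.

Lemma dotp_eq0 u : dotp u u = 0 -> u = 0.
Proof.
move=> u0; apply/rowP => i; rewrite mxE.
by apply/eqP; rewrite -sqrf_eq0 eq_le sqr_ge0 -u0 coord_sqr_le_dotp.
Qed.

Lemma enorm_sqr u : enorm u ^+ 2 = dotp u u.
Proof. by rewrite sqr_sqrtr// dotp_ge0. Qed.

Lemma enorm_ge0 u : 0 <= enorm u.
Proof. exact: sqrtr_ge0. Qed.

Lemma norm_coord_le_enorm u i : `|u 0 i| <= enorm u.
Proof.
by rewrite -(@ler_pXn2r _ 2) ?nnegrE ?enorm_ge0// enorm_sqr real_normK
  ?num_real ?coord_sqr_le_dotp.
Qed.

End InnerProduct.

Section SmoothConvex.
Context {R : realType} {n : nat}.
Implicit Types (w : 'rV[R]_n) (F : 'rV[R]_n -> R).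

Lemma smooth_grad_sqr L F (sF : smooth L F) w w' :
  dotp (grad F w - grad F w') (grad F w - grad F w')
    <= L ^+ 2 * dotp (w - w') (w - w').
Proof.
rewrite -!enorm_sqr -exprMn ler_pXn2r ?nnegrE ?enorm_ge0//.
exact: le_trans (enorm_ge0 _) (sF w w').
Qed.

(** With u the gradient difference and d = w - w', expanding |u - L d|^2 >= 0 gives 2 L <u, d> <=
    |u|^2 + L^2 |d|^2, and smoothness bounds the right side by 2 L^2 |d|^2. *)
Lemma smooth_dotp_le L F (L0 : 0 < L) (sF : smooth L F) w w' :
  dotp (grad F w - grad F w') (w - w') <= L * dotp (w - w') (w - w').
Proof.
have := smooth_grad_sqr sF w w'.
have := dotp_ge0 (grad F w - grad F w' - L *: (w - w')).
move: (grad F w - grad F w') (w - w') => u d; rewrite !dotp_linear (dotpC d u).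
move=> h1 h2; rewrite -(ler_pM2l L0).
lra.
Qed.

(* The segment is cut into m pieces and convexity is used at the end of each
   piece, which gives the bound with L (1 + 1/m) instead of L. *)
Lemma descent L F (L0 : 0 < L) (cF : grad_convex F) (sF : smooth L F) w w' :
  F w - F w' <= dotp (grad F w') (w - w') + L / 2 * dotp (w - w') (w - w').
Proof.
have [d dE] : {d | d = w - w'} by exists (w - w').
rewrite -dE.
have step (m : nat) : F w - F w' <=
    dotp (grad F w') d + L / 2 * dotp d d + (L / 2 * dotp d d) / m.+1%:R.
  pose M : R := m.+1%:R; pose p (k : nat) := w' + (k%:R / M) *: d.
  have M0 : 0 < M by rewrite ltr0n.
  (* Passing from [p k] to [p k.+1] costs at most 1/M times the slope at [p k.+1], which by
     smoothness exceeds the slope at w' by at most L (k + 1) / M times |d|^2. The factor k (k + 1) /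
     2 is the sum of these excesses. *)
  have pE k : F (p k) - F w' <= k%:R / M * dotp (grad F w') d
      + L / M ^+ 2 * (k%:R * (k%:R + 1) / 2) * dotp d d.
    elim: k => [|k IH].
      by rewrite /p !mul0r scale0r addr0 subrr mulr0 mul0r addr0.
    have := cF (p k) (p k.+1).
    have -> : p k - p k.+1 = - (M^-1 *: d).
      by apply/rowP => i; rewrite !mxE -natr1; field; rewrite gt_eqF.
    have := smooth_dotp_le L0 sF (p k.+1) w'.
    have -> : p k.+1 - w' = (k.+1%:R / M) *: d by rewrite /p addrC addKr.
    rewrite !dotp_linear -(natr1 k).
    move: IH (dotp_ge0 d).
    move: (dotp (grad F (p k.+1)) d) (dotp (grad F w') d) (dotp d d) (F (p k)) (F (p k.+1)).
    move=> G1 G0 D a b IH D0.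
    have k0 : 0 < k%:R + 1 :> R by rewrite ltr_wpDl.
    move=> h1 h2.
    have h3 : M^-1 * (G1 - G0) <= L * ((k%:R + 1) / M ^+ 2) * D.
      rewrite -(ler_pM2l k0); move: h1; congr (_ <= _); first by field; rewrite gt_eqF.
      by field; rewrite gt_eqF.
    have -> : (k%:R + 1) / M * G0 + L / M ^+ 2 * ((k%:R + 1) * (k%:R + 1 + 1) / 2) * D
       = (k%:R / M * G0 + L / M ^+ 2 * (k%:R * (k%:R + 1) / 2) * D)
         + M^-1 * G0 + L * ((k%:R + 1) / M ^+ 2) * D.
      by field; rewrite gt_eqF.
    move: h3 h2 IH {h1}; rewrite mulrBr.
    move: (M^-1 * G1) (M^-1 * G0) (L * _ * D) (_ + L / _ * _ * D) => *; lra.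
  have := pE m.+1; rewrite /p -/M divff ?gt_eqF// scale1r dE subrKC -dE.
  move=> /le_trans; apply; rewrite le_eqVlt; apply/orP; left; apply/eqP.
  by field; rewrite gt_eqF.
apply/ler_addgt0Pr => e e0; set c := L / 2 * dotp d d in step *.
have c0 : 0 <= c by rewrite mulr_ge0 ?dotp_ge0// divr_ge0 ?ltW.
(* This choice makes the error term c / (m + 1) at most e. *)
pose m := Num.truncn (c / e).
apply: le_trans (step m) _; rewrite lerD2l ler_pdivrMr ?ltr0n// mulrC -ler_pdivrMr//.
exact/ltW/truncnS_gt.
Qed.

(** In [half], with u = grad F v - grad F v', the value of F at v - u / L is bounded above by
    [descent] from v and below by convexity at v'. Adding [half] for both orders of w and w' cancels
    the values of F. *)
Lemma cocoercive L F (L0 : 0 < L) (cF : grad_convex F) (sF : smooth L F) w w' :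
  dotp (grad F w - grad F w') (grad F w - grad F w')
    <= L * dotp (grad F w - grad F w') (w - w').
Proof.
have half v v' : dotp (grad F v - grad F v') (grad F v - grad F v') / (2 * L)
    <= F v - F v' - dotp (grad F v') (v - v').
  have := descent L0 cF sF (v - L^-1 *: (grad F v - grad F v')) v.
  have := cF (v - L^-1 *: (grad F v - grad F v')) v'.
  rewrite [v - _ - v]addrAC subrr add0r [v - _ - v']addrAC.
  have [u uE] : {u | u = grad F v - grad F v'} by eexists.
  rewrite -uE; have -> : grad F v = grad F v' + u by rewrite uE subrKC.
  rewrite !dotp_linear.
  move: (dotp u u) (dotp (grad F v') u) (dotp (grad F v') v) (dotp (grad F v') v').
  move=> D G1 G2 G3.
  have -> : D / (2 * L) = L^-1 * D / 2 by field; rewrite gt_eqF.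
  have -> : L / 2 * - - (L^-1 * (L^-1 * D)) = L^-1 * D / 2 by field; rewrite gt_eqF.
  by lra.
have := half w w'; have := half w' w.
have -> : grad F w' - grad F w = - (grad F w - grad F w') by rewrite opprB.
have [u uE] : {u | u = grad F w - grad F w'} by eexists.
rewrite -uE; have -> : grad F w = grad F w' + u by rewrite uE subrKC.
rewrite !dotp_linear !opprK.
move: (dotp u u) (dotp u w) (dotp u w') => D G1 G2 h1 h2.
have : D / L <= G1 - G2.
  have -> : D / L = D / (2 * L) + D / (2 * L) by field; rewrite gt_eqF.
  by lra.
by rewrite ler_pdivrMr// mulrC.
Qed.

Lemma strongly_convex_monotone mu F (sc : strongly_convex mu F) w w' :
  mu * dotp (w - w') (w - w') <= dotp (grad F w - grad F w') (w - w').
Proof.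
have := sc w w'; have := sc w' w; rewrite !enorm_sqr.
have -> : w' - w = - (w - w') by rewrite opprB.
rewrite !dotp_linear; lra.
Qed.


(** After a step of length 1/(2L) against g = grad F w, [gL] keeps <grad F z, g> at least |g|^2 / 2,
    while strong convexity at z and minimality of w make it nonpositive; hence g = 0. The bound [gL]
    is linear in the gradients, so that for an expected function it follows from the samples by
    averaging. *)
Lemma convex_smooth_min_grad0 L mu F w (L0 : 0 < L) (mu0 : 0 < mu)
    (sc : strongly_convex mu F)
    (gL : forall w w', dotp (grad F w - grad F w') (w - w')
      <= L * dotp (w - w') (w - w')) :
  is_argmin F w -> grad F w = 0.
Proof.
move=> wmin; apply: dotp_eq0; apply/eqP; rewrite eq_le dotp_ge0 andbT.
have [g gE] : {g | g = grad F w} by eexists.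
pose z := w - (2 * L)^-1 *: g.
have := gL z w; have := sc w z; have := wmin z; rewrite enorm_sqr -gE.
have -> : z - w = - ((2 * L)^-1 *: g) by rewrite /z addrAC subrr add0r.
have -> : w - z = (2 * L)^-1 *: g by rewrite /z subKr.
rewrite !dotp_linear.
have -> x : L * - - ((2 * L)^-1 * ((2 * L)^-1 * x)) = (2 * L)^-1 * x / 2.
  by field; rewrite gt_eqF.
move: (dotp_ge0 g) (F z) (dotp (grad F z) g) => D0 Fz G h1 h2.
have i0 : 0 < (2 * L)^-1 by rewrite invr_gt0 mulr_gt0.
have : 0 <= mu / 2 * ((2 * L)^-1 * ((2 * L)^-1 * dotp g g)).
  by rewrite !mulr_ge0// ?ltW// invr_ge0.
move=> h3 h4; rewrite -(pmulr_rle0 _ i0); lra.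
Qed.

End SmoothConvex.

(* (s - 1) (s - 2) is the integrating factor of the recursion, s = t + E. *)
Lemma recursion_linear_growth {R : realType} (E c : R) (y : nat -> R) t :
  4 <= E -> 0 <= c ->
  (forall t, y t.+1 <= (1 - 2 / (t%:R + E)) * y t + c / (t%:R + E) ^+ 2) ->
  (t%:R + E - 1) * (t%:R + E - 2) * y t <= (E - 1) * (E - 2) * y 0%N + c * t%:R.
Proof.
move=> E4 c0 y_rec; elim: t => [|t IH]; first by rewrite add0r mulr0 addr0.
have s4 : 4 <= t%:R + E by rewrite ler_wpDl.
have := y_rec t; rewrite -(natr1 t); move: IH s4.
set X := (E - 1) * _ * _; have -> : t%:R + 1 + E = (t%:R + E) + 1 by ring.
move: (t%:R + E) => s; move: (t%:R) (y t) (y t.+1) => r a b IH s4 h.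
have s0 : 0 < s by lra.
have s10 : 0 < s * (s - 1) by rewrite mulr_gt0//; lra.
move: h; rewrite -(ler_pM2l s10).
(* The old value reappears with its own weight (s - 1) (s - 2), and the noise adds c - c / s, at
   most c per step. *)
have -> : s * (s - 1) * ((1 - 2 / s) * a + c / s ^+ 2)
    = (s - 1) * (s - 2) * a + (c - c / s).
  by field; rewrite gt_eqF.
have : 0 <= c / s by rewrite divr_ge0// ltW.
have -> : (s + 1 - 1) * (s + 1 - 2) = s * (s - 1) by ring.
move: (c / s) (s * (s - 1) * b) ((s - 1) * (s - 2) * a) IH => *; lra.
Qed.

(** The role of M is to make c E M dominate the weighted initial value, so that the linear growth
    bound becomes c (E M + t). *)
Lemma recursion_rate {R : realType} (E c M : R) (y : nat -> R) t :
  4 <= E -> 0 <= c ->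
  (forall t, y t.+1 <= (1 - 2 / (t%:R + E)) * y t + c / (t%:R + E) ^+ 2) ->
  0 <= y 0%N -> E * y 0%N <= c * M -> 1 <= M ->
  E * M - E <= t%:R -> y t <= 4 * c / (t%:R - (E * M - E) + E).
Proof.
move=> E4 c0 y_rec y0 yM M1 tT; have := recursion_linear_growth t E4 c0 y_rec.
have s4 : 4 <= t%:R + E by rewrite ler_wpDl.
have Ey0 : (E - 1) * (E - 2) * y 0%N <= c * (E * M).
  have -> : c * (E * M) = E * (c * M) by ring.
  have h1 : E * (E * y 0%N) <= E * (c * M) by rewrite ler_pM2l//; lra.
  apply: le_trans h1; rewrite mulrA; apply: ler_wpM2r => //; nra.
move=> h; have {h Ey0} : (t%:R + E - 1) * (t%:R + E - 2) * y t
    <= c * (E * M + t%:R) by lra.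
have q0 : 0 < t%:R - (E * M - E) + E by lra.
rewrite ler_pdivlMr//.
have p0 : 0 < (t%:R + E - 1) * (t%:R + E - 2) by rewrite mulr_gt0//; lra.
rewrite -(ler_pM2r q0) => h; rewrite -(ler_pM2l p0) mulrA; apply: le_trans h _.
have -> : (t%:R + E - 1) * (t%:R + E - 2) * (4 * c)
    = c * (4 * ((t%:R + E - 1) * (t%:R + E - 2))) by ring.
rewrite -mulrA ler_wpM2l//.
(* With s = t + E and a = E M - E, the left factors are s + a and s - a, of product at most s^2.
   Since s >= 4, 4 (s - 1) (s - 2) - s^2 = 3 s (s - 4) + 8 is positive. *)
have := sqr_ge0 (E * M - E); move: (E * M) tT => K tT; nra.
Qed.

(** * Measurability and independence *)

Section Measurability.
Context {R : realType} {n : nat}.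

(** A partial derivative is the pointwise limit of difference quotients along the increments 1/(k +
    1), each measurable in x. *)
Lemma measurable_grad d (X : measurableType d) (f : 'rV[R]_n -> X -> R) w i :
  (forall w, measurable_fun setT (f w)) ->
  (forall x w, differentiable (f ^~ x) w) ->
  measurable_fun setT (fun x => grad (f ^~ x) w 0 i).
Proof.
move=> mf df; pose h (k : nat) : R := k.+1%:R^-1.
apply: (measurable_fun_cvg (h := fun k x =>
  (h k)^-1 *: (f (h k *: delta_mx 0 i + w) x - f w x))) => [k|x _].
  apply: measurable_funM => //; apply: measurable_funB; exact: mf.
rewrite mxE; have := diff_derivable (v := delta_mx 0 i) (df x w).
move=> /cvgr_dnbhsP; apply; split => [k|]; first by rewrite invr_neq0.
exact: cvg_harmonic.
Qed.

(** Rounding down to mesh 1/(k + 1), recorded as an integer vector so that there are only countably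
    many values. *)
Definition grid (k : nat) (w : 'rV[R]_n) : 'rV[int]_n :=
  \row_i Num.floor (w 0 i * k.+1%:R).

Definition of_grid (k : nat) (z : 'rV[int]_n) : 'rV[R]_n :=
  \row_i ((z 0 i)%:~R / k.+1%:R).

Lemma cvg_of_grid (w : 'rV[R]_n) : of_grid k (grid k w) @[k --> \oo] --> w.
Proof.
apply/cvg_ballP => e e0; near=> k; split => // i j.
have k0 : 0 < k.+1%:R :> R by rewrite ltr0n.
rewrite ord1 /ball /= !mxE; apply: (@le_lt_trans _ _ k.+1%:R^-1); last first.
  by near: k; exact: near_infty_natSinv_lt (PosNum e0).
have /andP[] := floor_itv (w 0 j * k.+1%:R).
rewrite -ler_pdivrMr// intrD -ltr_pdivlMr// mulrDl mul1r => h1 h2.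
by rewrite ger0_norm ?subr_ge0// lerBlDl ltW.
Unshelve. all: by end_near. Qed.

(* h (V t) (Z t) is the limit of its values at the grid points below V t, each of
   which is glued from countably many measurable pieces. *)
Lemma measurable_fun_caratheodory d d' (T : measurableType d)
    (X : measurableType d') (V : T -> 'rV[R]_n) (Z : T -> X)
    (h : 'rV[R]_n -> X -> R) :
  (forall i, measurable_fun setT (fun t => V t 0 i)) ->
  measurable_fun setT Z ->
  (forall w, measurable_fun setT (h w)) ->
  (forall x, continuous (h ^~ x)) ->
  measurable_fun setT (fun t => h (V t) (Z t)).
Proof.
move=> mV mZ mh ch.
apply: (measurable_fun_cvg (h := fun k t => h (of_grid k (grid k (V t))) (Z t))).
  move=> k _ B mB; rewrite setTI.
  have mgrid z : measurable [set t | grid k (V t) = z].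
    rewrite (_ : [set _ | _] = \bigcap_(i in [set: 'I_n])
       (fun t => V t 0 i * k.+1%:R) @^-1` `[(z 0 i)%:~R, (z 0 i + 1)%:~R[%classic).
      apply: fin_bigcap_measurable => // i _.
      rewrite -[X in measurable X]setTI; apply: measurable_funM => //.
    apply/seteqP; split => t /=.
      by move=> <- i _ /=; rewrite in_itv /= mxE; exact: floor_itv.
    move=> tz; apply/rowP => i; rewrite mxE; apply: floor_def.
    by have := tz i I; rewrite /= in_itv.
  rewrite (_ : _ @^-1` B = \bigcup_(z in [set: 'rV[int]_n])
     ([set t | grid k (V t) = z] `&` Z @^-1` (h (of_grid k z) @^-1` B))).
    apply: countable_bigcupT_measurable => [|z]; first exact: countableP.
    apply: measurableI => //.

    rewrite -[X in measurable X]setTI; apply: mZ => //.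
    by rewrite -[X in measurable X]setTI; apply: mh.
  apply/seteqP; split => t /=; first by exists (grid k (V t)).
  by move=> [z _ [<-]].
move=> t _; exact: (cvg_comp _ (h ^~ (Z t)) (@cvg_of_grid (V t)) (@ch (Z t) (V t))).
Qed.

End Measurability.

Section Independence.
Context {R : realType} {d : measure_display} {T : measurableType d}.
Variable P : probability T R.
Local Open Scope ereal_scope.

(** Dynkin's pi-lambda argument: the measurable sets independent of B are stable under complement
    and countable disjoint union. *)
Lemma independent_g_sigma (G : set (set T)) (B : set T) :
  setI_closed G -> G `<=` measurable -> measurable B ->
  (forall A, G A -> P (A `&` B) = P A * P B) ->
  forall A, <<s G >> A -> measurable A /\ P (A `&` B) = P A * P B.
Proof.
move=> GI mG mB indG; have fP C : measurable C -> P C \is a fin_num.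
  by move=> mC; exact: fin_num_measure.
pose ind (A : set T) := measurable A /\ P (A `&` B) = P A * P B.
have indC A : ind A -> ind (~` A).
  move=> [mA indA]; split; first exact: measurableC.
  rewrite setIC -setDE measureD//; last by rewrite ltey_eq fP.
  by rewrite setIC [X in _ - X]indA probability_setC// muleBl ?fP// mul1e.
have indU (F : (set T)^nat) : trivIset setT F -> (forall k, ind (F k)) ->
    ind (\bigcup_k F k).
  move=> tF mF; split; first by apply: bigcup_measurable => k _; case: (mF k).
  rewrite setI_bigcupl !measure_bigcup//; last 3 first.
  - by move=> k _; case: (mF k).
  - by move=> k _; apply: measurableI => //; case: (mF k).
  - exact: trivIset_setIr.
  rewrite muleC -(fineK (fP _ mB)) -nneseriesZl//.
  by apply: eq_eseriesr => k _; rewrite (fineK (fP _ mB)) muleC; case: (mF k).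
apply: (@dynkin_induction _ (g_sigma_algebraType G) G ind) => //.
- by split=> //; rewrite setTI probability_setT mul1e.
- by move=> A GA; split; [exact: mG|exact: indG].
- by move=> A _; exact: indC.
- by move=> F _; exact: indU.
Qed.

(** The product formula on rectangles identifies the law of (V, Z) with the product law, and Tonelli
    then integrates out Z with V held fixed. *)
Lemma integral_frozen d1 d2 (Y : measurableType d1) (X : measurableType d2)
    (V : {mfun T >-> Y}) (Z : {mfun T >-> X}) (Phi : Y * X -> \bar R) :
  (forall A B, measurable A -> measurable B ->
    P (V @^-1` A `&` Z @^-1` B) = P (V @^-1` A) * P (Z @^-1` B)) ->
  measurable_fun setT Phi -> (forall z, 0 <= Phi z) ->
  \int[P]_t Phi (V t, Z t) = \int[P]_t \int[distribution P Z]_x Phi (V t, x).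
Proof.
move=> indVZ mPhi Phi0.
have mW : measurable_fun setT (fun t => (V t, Z t)).
  by apply: measurable_fun_pair.
pose W : {mfun T >-> (Y * X)%type} := HB.pack (fun t => (V t, Z t))
  (isMeasurableFun.Build _ _ _ _ _ mW).
rewrite -[LHS](ge0_integral_distribution (P := P) W mPhi)//.
rewrite (eq_measure_integral (distribution P V \x distribution P Z)); last first.
  by move=> C mC _; apply/esym/product_measure_unique => // A B mA mB; exact: indVZ.
rewrite fubini_tonelli1// ge0_integral_distribution//.
- exact: measurable_fun_fubini_tonelli_F.
- by move=> y; exact: integral_ge0.
Qed.

Context {dX : measure_display} {X : measurableType dX}.

(* A pi-system that generates the sigma-algebra of xis 0, ..., xis (t - 1). *)
Definition history (xis : nat -> T -> X) (t : nat) : set (set T) :=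
  [set C | exists2 A : nat -> set X, (forall s, measurable (A s)) &
    C = \bigcap_(s < t) (xis s @^-1` A s)].

Lemma history_setI_closed xis t : setI_closed (history xis t).
Proof.
move=> _ _ [A mA ->] [B mB ->]; exists (fun s => A s `&` B s).
  by move=> s; exact: measurableI.
by rewrite -bigcapI.
Qed.

Lemma history_measurable (xis : nat -> {RV P >-> X}) t :
  history xis t `<=` measurable.
Proof.
move=> _ [A mA ->]; apply: bigcap_measurableType => s _.
by rewrite -[X in measurable X]setTI; exact: measurable_funP.
Qed.

Lemma history_preimage (xis : nat -> T -> X) t s B : (s < t)%N -> measurable B ->
  history xis t (xis s @^-1` B).
Proof.
move=> st mB; exists (fun r => if r == s then B else setT).
  by move=> r; case: ifP.
apply/seteqP; split => om /=.
  by move=> Bom r _ /=; case: eqP => // ->.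
by move=> /(_ s st) /=; rewrite eqxx.
Qed.

(** On the generating sets, mutual independence is used twice, for the times below t and for these
    times together with t; the quotient of the two product formulas is the factor at time t.
    [independent_g_sigma] extends this to the whole sigma-algebra of the past. *)
Lemma history_independent (xis : nat -> {RV P >-> X}) t C B :
  mutually_independent xis -> <<s history xis t >> C -> measurable B ->
  P (C `&` xis t @^-1` B) = P C * P (xis t @^-1` B).
Proof.
move=> ind sC mB.
suff: measurable C /\ P (C `&` xis t @^-1` B) = P C * P (xis t @^-1` B) by case.
move: C sC; apply: independent_g_sigma.
- exact: history_setI_closed.
- exact: history_measurable.
- by rewrite -[X in measurable X]setTI; exact: measurable_funP.
move=> _ [A mA ->]; pose J := [fset s in iota 0 t]%fset.
have inJ s : (s \in J) = (s < t)%N by rewrite !inE mem_iota add0n.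
have JE : [set` J] = `I_t by apply/seteqP; split => s /=; rewrite inJ.
have tJ : t \notin J by rewrite inJ ltnn.
pose A' s := if s == t then B else A s.
have A'E s : s \in J -> A' s = A s.
  by rewrite /A'; case: eqP => // ->; rewrite (negbTE tJ).
have := ind (t |` J)%fset A'.
have A't : A' t = B by rewrite /A' eqxx.
rewrite big_fsetU1//= A't muleC.
under [X in X * _]eq_fbigr => s sJ _ do rewrite A'E//.
rewrite -(ind J A)// JE => <-; last by move=> s; rewrite /A'; case: ifP.
congr (P _); apply/seteqP; split => om /=.
  move=> [h1 h2] s; rewrite /= in_fset1U => /predU1P[->|].
    by rewrite A't.
  by move=> sJ; rewrite A'E//; have := h1 s; rewrite /= -inJ; exact.
move=> h; split.
  move=> s /=; rewrite -inJ => sJ; have := h s; rewrite A'E//; apply.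
  by rewrite /= in_fset1U sJ orbT.
by have := h t; rewrite A't; apply; rewrite /= in_fset1U eqxx.
Qed.

End Independence.

Lemma dotp_le_mx_norm {R : realType} {n : nat} (u : 'rV[R]_n) :
  dotp u u <= n%:R * `|u| ^+ 2.
Proof.
have -> : n%:R * `|u| ^+ 2 = \sum_(i < n) `|u| ^+ 2 :> R.
  by rewrite sumr_const card_ord mulr_natl.
apply: ler_sum => i _; rewrite -expr2 -[leLHS]real_normK ?num_real//.
rewrite ler_pXn2r ?nnegrE// [leRHS]/Num.norm /= mx_normrE.
by apply/bigmax_geP; right; exists (0, i).
Qed.

Lemma smooth_grad_continuous {R : realType} {n : nat} L (F : 'rV[R]_n -> R) i :
  0 < L -> smooth L F -> continuous (fun w => grad F w 0 i).
Proof.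
(* C converts the Euclidean Lipschitz constant to the sup norm; [n.+1] keeps it positive in
   dimension 0. *)
move=> L0 sF w; pose C := L * Num.sqrt n.+1%:R.
have C0 : 0 < C by rewrite mulr_gt0// sqrtr_gt0 ltr0n.
apply/(@cvgrPdist_lt _ _ _ (nbhs w)) => e e0.
apply/(@nbhs_normP R 'rV[R]_n); exists (e / C); [exact: divr_gt0|move=> z /= wz].
have -> : grad F w 0 i - grad F z 0 i = (grad F w - grad F z) 0 i by rewrite !mxE.
apply: le_lt_trans (norm_coord_le_enorm _ i) _.
apply: le_lt_trans (sF w z) _; apply: (@le_lt_trans _ _ (C * `|w - z|)).
  rewrite /C -mulrA ler_pM2l// -(@ler_pXn2r _ 2) ?nnegrE ?enorm_ge0 ?mulr_ge0//.
  rewrite enorm_sqr exprMn sqr_sqrtr ?ler0n//.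
  by apply: le_trans (dotp_le_mx_norm _) _; rewrite ler_wpM2r ?sqr_ge0// ler_nat.
by rewrite mulrC -ltr_pdivlMr.
Qed.

(** * Means of integrable real random variables *)

Section Mean.
Context {R : realType} {d : measure_display} {T : measurableType d}.
Variable P : probability T R.
Implicit Types (Y Z : T -> R).

Lemma has_mean_cst k : has_mean P (fun=> k) k.
Proof.
split; first exact: finite_measure_integrable_cst.
exact: expectation_cst.
Qed.

Lemma has_meanD Y Z a b : has_mean P Y a -> has_mean P Z b ->
  has_mean P (fun t => Y t + Z t) (a + b).
Proof.
move=> [iY EY] [iZ EZ]; split.
  exact: (@integrableD _ _ _ _ setT _ (EFin \o Y) (EFin \o Z)).
by rewrite EFinD -EY -EZ unlock -integralD_EFin.
Qed.

Lemma has_meanZ k Y a : has_mean P Y a -> has_mean P (fun t => k * Y t) (k * a).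
Proof.
move=> [iY EY]; split.
  exact: (@integrableZl _ _ _ _ setT _ k (EFin \o Y)).
by rewrite EFinM -EY unlock -integralZl.
Qed.

Lemma has_mean_sum I (s : seq I) (Y : I -> T -> R) (a : I -> R) :
  (forall i, has_mean P (Y i) (a i)) ->
  has_mean P (fun t => \sum_(i <- s) Y i t) (\sum_(i <- s) a i).
Proof.
move=> mY; elim: s => [|i s IH].
  by under eq_fun do rewrite big_nil; rewrite big_nil; exact: has_mean_cst.
by under eq_fun do rewrite big_cons; rewrite big_cons; exact: has_meanD.
Qed.

Lemma has_mean_le Y Z a b : has_mean P Y a -> has_mean P Z b ->
  (forall t, Y t <= Z t) -> a <= b.
Proof.
move=> [iY EY] [iZ EZ] YZ; rewrite -lee_fin -EY -EZ unlock.
by apply: le_integral => // t _; rewrite lee_fin.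
Qed.

Lemma has_mean_dominated Y Z b : measurable_fun setT Y -> (forall t, 0 <= Y t) ->
  has_mean P Z b -> (forall t, Y t <= Z t) -> ('E_P[Y] <= b%:E)%E.
Proof.
move=> mY Y0 [iZ <-] YZ; rewrite unlock; apply: le_integral => //.
  apply: le_integrable iZ => //; first exact/measurable_EFinP.
  by move=> t _ /=; rewrite lee_fin !ger0_norm// (le_trans (Y0 t)).
by move=> t _; rewrite lee_fin.
Qed.

Lemma has_mean_ge0 Y a : measurable_fun setT Y -> (forall t, 0 <= Y t) ->
  ('E_P[Y] = a%:E)%E -> has_mean P Y a.
Proof.
move=> mY Y0 EY; split=> //; apply/integrableP; split; first exact/measurable_EFinP.
under eq_integral do rewrite /= ger0_norm//.
by move: EY; rewrite unlock => ->; rewrite ltry.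
Qed.

Lemma has_mean_dotp n (u : T -> 'rV[R]_n) (m v : 'rV[R]_n) :
  (forall i, has_mean P (fun t => u t 0 i) (m 0 i)) ->
  has_mean P (fun t => dotp (u t) v) (dotp m v).
Proof.
move=> hu; apply: has_mean_sum => i.
by under eq_fun do rewrite mulrC; rewrite mulrC; exact: has_meanZ.
Qed.

End Mean.

(** * One step of the iteration *)

(** Write a, b for the gradients at v, w. In the expanded square, |a|^2 <= 2 |a - b|^2 + 2 |b|^2,
    which is |a - 2 b|^2 >= 0, and cocoercivity bounds |a - b|^2. Apart from |b|^2 the result is
    affine in a and b, so its mean can be taken term by term. *)
Lemma sqr_dist_sgd_step_le {R : realType} {n : nat} L (F : 'rV[R]_n -> R) v w eta :
  0 < L -> grad_convex F -> smooth L F ->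
  dotp (v - eta *: grad F v - w) (v - eta *: grad F v - w) <=
    dotp (v - w) (v - w) + (2 * L * eta ^+ 2 - 2 * eta) * dotp (grad F v) (v - w)
    + - (2 * L * eta ^+ 2) * dotp (grad F w) (v - w)
    + 2 * eta ^+ 2 * dotp (grad F w) (grad F w).
Proof.
move=> L0 cF sF; have := cocoercive L0 cF sF v w.
have := dotp_ge0 (grad F v - 2 *: grad F w).
rewrite [v - _ - w]addrAC.
move: (v - w) (grad F v) (grad F w) (sqr_ge0 eta) => d a b e0.
rewrite !dotp_linear (dotpC b a) (dotpC d a).
move: (dotp a a) (dotp a b) (dotp b b) (dotp a d) (dotp b d) => aa ab bb ad bd.
move: (dotp d d) => dd h1 h2.
have : 0 <= eta ^+ 2 * (2 * (L * (ad - bd)) + 2 * bb - aa) by rewrite mulr_ge0//; lra.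
lra.
Qed.

Section Step.
Context {R : realType} {n : nat} {d d' : measure_display}.
Context {T : measurableType d} {X : measurableType d'}.
Context (f : 'rV[R]_n -> X -> R) (L : R).
Hypothesis f_meas : forall w, measurable_fun setT (f w).
Hypothesis f_diff : forall x w, differentiable (f ^~ x) w.
Hypothesis L_gt0 : 0 < L.
Hypothesis f_smooth : forall x, smooth L (f ^~ x).

Lemma measurable_grad_comp d1 (S : measurableType d1) (V : S -> 'rV[R]_n)
    (Z : S -> X) i :
  (forall i, measurable_fun setT (fun s => V s 0 i)) -> measurable_fun setT Z ->
  measurable_fun setT (fun s => grad (f ^~ (Z s)) (V s) 0 i).
Proof.
move=> mV mZ.
apply: (measurable_fun_caratheodory (h := fun w x => grad (f ^~ x) w 0 i)) => //.
- by move=> w; exact: measurable_grad.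
- by move=> x; exact: (smooth_grad_continuous L_gt0 (f_smooth x)).
Qed.

Lemma measurable_dotp d1 (S : measurableType d1) (U V : S -> 'rV[R]_n) :
  (forall i, measurable_fun setT (fun s => U s 0 i)) ->
  (forall i, measurable_fun setT (fun s => V s 0 i)) ->
  measurable_fun setT (fun s => dotp (U s) (V s)).
Proof. by move=> mU mV; apply: measurable_sum => i; exact: measurable_funM. Qed.

Lemma measurable_sgd_step d1 (S : measurableType d1) (V : S -> 'rV[R]_n)
    (Z : S -> X) e i :
  (forall i, measurable_fun setT (fun s => V s 0 i)) -> measurable_fun setT Z ->
  measurable_fun setT (fun s => (V s - e *: grad (f ^~ (Z s)) (V s)) 0 i).
Proof.
move=> mV mZ; under eq_fun do rewrite mxE -scaleNr [X in _ + X]mxE.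
apply: measurable_funD => //; apply: measurable_funM => //.
exact: measurable_grad_comp.
Qed.

(** The source space is arbitrary and only the samples before t need be measurable, so that the
    sigma-algebra of the past can be put on it. *)
Lemma measurable_sgd d1 (S : measurableType d1) w0 eta (Z : nat -> S -> X) t i :
  (forall s, (s < t)%N -> measurable_fun setT (Z s)) ->
  measurable_fun setT (fun om => sgd f w0 eta Z t om 0 i).
Proof.
elim: t i => [|t IH] i mZ /=; first exact: measurable_cst.
apply: measurable_sgd_step; last exact: mZ.
by move=> j; apply: IH => s st; apply: mZ; exact: ltnW.
Qed.

Context (P : probability T R).

(** The inequality is between extended reals, so it can be iterated before the iterates are known to
    be square-integrable. Nonnegative k and b allow the integral of the bound to be split. *)
Lemma expectation_sgd_step w0 eta (xi : {RV P >-> X}) (xis : nat -> {RV P >-> X})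
    wstar t k b :
  iid_copies xi xis -> 0 <= k -> 0 <= b ->
  (forall v, 'E_P[fun om => (enorm (v - eta t *: grad (f ^~ (xi om)) v - wstar) ^+ 2)%R]
    <= (k * enorm (v - wstar) ^+ 2 + b)%:E)%E ->
  ('E_P[fun om => (enorm (sgd f w0 eta xis t.+1 om - wstar) ^+ 2)%R] <=
   k%:E * 'E_P[fun om => (enorm (sgd f w0 eta xis t om - wstar) ^+ 2)%R] + b%:E)%E.
Proof.
move=> [same ind] k0 b0 bound.
(* Y is T with the sigma-algebra of the past: the t-th iterate is measurable
   on Y and the identity of T, as a Y-valued variable, is independent of
   xis t, so no conditional expectation is needed. *)
pose G := history xis t; pose Y := g_sigma_algebraType G.
have mid : measurable_fun setT (id : T -> Y).
  move=> _ B mB; rewrite setTI; suff : <<s G >> `<=` @measurable _ T by exact.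
  apply: smallest_sub; last exact: history_measurable.
  exact: sigma_algebra_measurable.
pose V : {mfun T >-> Y} := HB.pack (id : T -> Y) (isMeasurableFun.Build _ _ _ _ _ mid).
pose w : Y -> 'rV[R]_n := sgd f w0 eta xis t.
have mw i : measurable_fun setT (fun om => w om 0 i).
  apply: (@measurable_sgd _ Y) => s st _ B mB; rewrite setTI.
  by apply: (@sub_sigma_algebra _ setT G); exact: history_preimage.
pose phi (v : 'rV[R]_n) (x : X) := enorm (v - eta t *: grad (f ^~ x) v - wstar) ^+ 2.
have mphi d1 (S : measurableType d1) (U : S -> 'rV[R]_n) (Z : S -> X) :
  (forall i, measurable_fun setT (fun s => U s 0 i)) -> measurable_fun setT Z ->
  measurable_fun setT (fun s => phi (U s) (Z s)).
  move=> mU mZ; rewrite /phi; under eq_fun do rewrite enorm_sqr.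
  have h i : measurable_fun setT
      (fun s => (U s - eta t *: grad (f ^~ (Z s)) (U s) - wstar) 0 i).
    under eq_fun do rewrite mxE; apply: measurable_funD; last by [].
    exact: measurable_sgd_step.
  exact: measurable_dotp.
have phi0 v x : (0 <= (phi v x)%:E)%E by rewrite lee_fin sqr_ge0.
have mwT i : measurable_fun setT (fun om : T => w om 0 i).
  exact: (measurableT_comp (mw i) mid).
have msq : measurable_fun setT (fun om : T => enorm (w om - wstar) ^+ 2).
  under eq_fun do rewrite enorm_sqr.
  have h i : measurable_fun setT (fun om : T => (w om - wstar) 0 i).
    by under eq_fun do rewrite mxE; exact: measurable_funD.
  exact: measurable_dotp.
rewrite unlock /= -/(w _).
rewrite (_ : (fun _ => _) = fun om => (phi (w (V om)) (xis t om))%:E); last by exact/funext.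
have mPhi : measurable_fun setT (fun z : Y * X => (phi (w z.1) z.2)%:E).
  apply/measurable_EFinP; apply: (mphi _ _ (fun z : Y * X => w z.1) snd) => //.
  by move=> i; exact: (measurableT_comp (mw i) measurable_fst).
rewrite (@integral_frozen _ _ _ P _ _ Y X V (xis t)
  (fun z => (phi (w z.1) z.2)%:E))//=; last first.
  by move=> A B sA mB; exact: (history_independent ind sA mB).
(* For a frozen v only the law of [xis t] matters; it is that of [xi], for which [bound] is
   stated. *)
have inner v : (\int[distribution P (xis t)]_x (phi v x)%:E <=
    (k * enorm (v - wstar) ^+ 2 + b)%:E)%E.
  have mphiv : measurable_fun setT (fun x => (phi v x)%:E).
    by apply/measurable_EFinP; apply: (mphi _ _ (fun=> v) id).
  rewrite (eq_measure_integral (distribution P xi)); last first.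
    by move=> B mB _; exact: same.
  by rewrite ge0_integral_distribution//; have := bound v; rewrite unlock.
apply: (@le_trans _ _ (\int[P]_om (k%:E * (enorm (w om - wstar) ^+ 2)%R%:E + b%:E)%E)%E).
  apply: ge0_le_integral => //.
  - by move=> om _; exact: integral_ge0.
  - exact: (measurableT_comp (measurable_fun_fubini_tonelli_F _ mPhi _) mid).
  - apply: emeasurable_funD => //; apply: measurable_funeM.
    exact/measurable_EFinP.
rewrite ge0_integralD//.
- have := expectation_cst P b; rewrite unlock => ->; rewrite ge0_integralZl//.
  + exact/measurable_EFinP.
  + by move=> om _; rewrite lee_fin sqr_ge0.
- by move=> om _; rewrite -EFinM lee_fin mulr_ge0// sqr_ge0.
- by apply: measurable_funeM; exact/measurable_EFinP.
Qed.

End Step.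

Section NoisyGradient.
Context {R : realType} {n : nat} {d d' : measure_display}.
Context {T : measurableType d} {X : measurableType d'} (P : probability T R).
Context (xi : {RV P >-> X}) (f : 'rV[R]_n -> X -> R) (F : 'rV[R]_n -> R) (L : R).
Hypothesis f_meas : forall w, measurable_fun setT (f w).
Hypothesis f_diff : forall x w, differentiable (f ^~ x) w.
Hypothesis L_gt0 : 0 < L.
Hypothesis f_smooth : forall x, smooth L (f ^~ x).
Hypothesis grad_mean : forall w i,
  has_mean P (fun om => grad (f ^~ (xi om)) w 0 i) (grad F w 0 i).

(** Pairing with the fixed vector w - w' is linear, so the bound for each sample passes to the
    mean. *)
Lemma mean_grad_dotp_le w w' :
  dotp (grad F w - grad F w') (w - w') <= L * dotp (w - w') (w - w').
Proof.
have hY : has_mean P (fun om => dotp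
    (grad (f ^~ (xi om)) w - grad (f ^~ (xi om)) w') (w - w'))
    (dotp (grad F w - grad F w') (w - w')).
  apply: has_mean_dotp => i; rewrite -scaleN1r !mxE.
  under eq_fun do rewrite -scaleN1r mxE [X in _ + X]mxE.
  rewrite -!/(grad F _ 0 i).
  apply: has_meanD.
    by have := grad_mean w i; rewrite !mxE.
  by apply: has_meanZ; have := grad_mean w' i; rewrite !mxE.
apply: (has_mean_le hY (has_mean_cst P _)) => om.
exact: smooth_dotp_le.
Qed.

Lemma expectation_sgd_step_le (mu N e : R) (w v : 'rV[R]_n) :
  (forall x, grad_convex (f ^~ x)) -> 0 < mu -> strongly_convex mu F ->
  grad F w = 0 ->
  has_mean P (fun om => dotp (grad (f ^~ (xi om)) w) (grad (f ^~ (xi om)) w)) (N / 2) ->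
  0 <= e -> 2 * L * e <= 1 ->
  ('E_P[fun om => (enorm (v - e *: grad (f ^~ (xi om)) v - w) ^+ 2)%R] <=
   ((1 - mu * e) * enorm (v - w) ^+ 2 + e ^+ 2 * N)%:E)%E.
Proof.
move=> cf mu0 sc Gw noise e0 e1.
have mxi : measurable_fun setT xi by exact: measurable_funP.
have hZ := has_meanD (has_meanD (has_meanD (has_mean_cst P (dotp (v - w) (v - w)))
  (has_meanZ (2 * L * e ^+ 2 - 2 * e) (has_mean_dotp (v - w) (grad_mean v))))
  (has_meanZ (- (2 * L * e ^+ 2)) (has_mean_dotp (v - w) (grad_mean w))))
  (has_meanZ (2 * e ^+ 2) noise).
under eq_fun do rewrite enorm_sqr.
apply: (le_trans (has_mean_dominated _ _ hZ _)).
- have h i : measurable_fun setT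
      (fun om => (v - e *: grad (f ^~ (xi om)) v - w) 0 i).
    under eq_fun do rewrite mxE; apply: measurable_funD => //.
    exact: (measurable_sgd_step f_meas f_diff L_gt0 f_smooth (V := fun=> v)).
  exact: measurable_dotp.
- by move=> om; exact: dotp_ge0.
- by move=> om; exact: sqr_dist_sgd_step_le.
rewrite lee_fin Gw enorm_sqr.
have -> : dotp 0 (v - w) = 0 by rewrite -[0](scale0r 0) dotpZl mul0r.
have := strongly_convex_monotone sc v w; rewrite Gw subr0.
have := dotp_ge0 (v - w); move: (dotp (grad F v) _) (dotp (v - w) (v - w)) => G D D0 h.
(* The coefficient 2 L e^2 - 2 e of G splits as - e - e (1 - 2 L e): the second part is discarded by
   [h1], the first turned into the contraction - mu e D by [h2]. *)
have h1 : 0 <= e * (1 - 2 * L * e) * G.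
  by rewrite !mulr_ge0 ?subr_ge0//; apply: le_trans h; rewrite mulr_ge0// ltW.
have h2 : 0 <= e * (G - mu * D) by rewrite mulr_ge0 ?subr_ge0//.
lra.
Qed.

(** If L < mu, the lower bound mu |u|^2 and the upper bound L |u|^2 on the same inner product force
    every u to vanish. The space is then trivial and the noise is zero, against N > 0. *)
Lemma strong_convexity_le_smoothness (mu N : R) (w : 'rV[R]_n) :
  strongly_convex mu F -> 0 < N ->
  ('E_P[fun om => (enorm (grad (f ^~ (xi om)) w) ^+ 2)%R] = N%:E)%E -> mu <= L.
Proof.
move=> sc N0 EN; rewrite leNgt; apply/negP => Lmu.
have dotp0 (u : 'rV[R]_n) : dotp u u = 0.
  have := strongly_convex_monotone sc u 0; have := mean_grad_dotp_le u 0.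
  rewrite subr0 => h1 h2; apply/eqP; rewrite eq_le dotp_ge0 andbT.
  have : (mu - L) * dotp u u <= 0 by lra.
  by rewrite pmulr_rle0// subr_gt0.
move: EN; under eq_fun do rewrite enorm_sqr dotp0.
rewrite expectation_cst => -[] N0'; by rewrite -N0' ltxx in N0.
Qed.

End NoisyGradient.

(** * Convergence rate of the iterates *)

Theorem theorem2 (R : realType) (n : nat) (dO dX : measure_display)
    (Omega : measurableType dO) (X : measurableType dX) (P : probability Omega R)
    (xi : {RV P >-> X}) (xis : nat -> {RV P >-> X})
    (f : 'rV[R]_n -> X -> R) (F : 'rV[R]_n -> R)
    (w0 wstar : 'rV[R]_n) (mu L N : R)
    (f_meas : forall w, measurable_fun setT (f w))
    (f_diff : forall (x : X) (w : 'rV[R]_n), differentiable (f ^~ x) w)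
    (F_mean : forall w, has_mean P (fun om => f w (xi om)) (F w))
    (F_diff : forall w : 'rV[R]_n, differentiable F w)
    (grad_mean : forall w (i : 'I_n),
      has_mean P (fun om => grad (f ^~ (xi om)) w 0 i) (grad F w 0 i))
    (xis_iid : iid_copies xi xis)
    (mu_gt0 : 0 < mu) (L_gt0 : 0 < L)
    (F_sc : strongly_convex mu F)
    (f_smooth : forall x, smooth L (f ^~ x))
    (f_convex : forall x, grad_convex (f ^~ x))
    (wstar_min : is_argmin F wstar)
    (N_def : (N%:E =
      2%:E * 'E_P[fun om => (enorm (grad (f ^~ (xi om)) wstar) ^+ 2)%R])%E)
    (N_gt0 : 0 < N) :
  let alpha : R := 2 in
  let E : R := 2 * alpha * L / mu in
  let eta : nat -> R := fun t => alpha / (mu * (t%:R + E)) in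
  let T : R :=
    4 * L / mu * Num.max (L * mu / N * enorm (w0 - wstar) ^+ 2) 1
    - 4 * L / mu in
  let w : nat -> Omega -> 'rV[R]_n := sgd f w0 eta xis in
  [/\ forall t, eta t <= eta 0%N,
      eta 0%N = 1 / (2 * L) &
      forall t : nat, T <= t%:R ->
        ('E_P[fun om => (enorm (w t om - wstar) ^+ 2)%R] <=
         (4 * alpha ^+ 2 * N / mu ^+ 2 * (1 / (t%:R - T + E)))%:E)%E].
Proof.
have sqr_meas : measurable_fun setT (fun om => dotp (grad (f ^~ (xi om)) wstar)
    (grad (f ^~ (xi om)) wstar)).
  by apply: measurable_dotp => i;
     exact: (measurable_grad_comp f_meas f_diff L_gt0 f_smooth (V := fun=> wstar)).
pose sqr_grad om := enorm (grad (f ^~ (xi om)) wstar) ^+ 2.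
have noiseE : ('E_P[sqr_grad] = (N / 2)%:E)%E.
  have : (0 <= 'E_P[sqr_grad])%E by apply: expectation_ge0 => om; exact: sqr_ge0.
  (* Nonnegativity excludes the value -oo, and the finiteness of [N%:E] excludes +oo. *)
  move: N_def; rewrite -/sqr_grad; case: ('E_P[sqr_grad])%E => [r| |] //=.
    by rewrite -EFinM => -[->] _; congr (_%:E); field.
  by rewrite mulry gtr0_sg// mul1e.
have noise : has_mean P (fun om => dotp (grad (f ^~ (xi om)) wstar)
    (grad (f ^~ (xi om)) wstar)) (N / 2).
  apply: has_mean_ge0 => //; first by move=> om; exact: dotp_ge0.
  by rewrite -noiseE /sqr_grad; under [in RHS]eq_fun do rewrite enorm_sqr.
have N2_gt0 : 0 < N / 2 by rewrite divr_gt0.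
have mu_le_L := strong_convexity_le_smoothness L_gt0 f_smooth grad_mean F_sc N2_gt0 noiseE.
have grad0 : grad F wstar = 0.
  apply: (convex_smooth_min_grad0 L_gt0 mu_gt0 F_sc _ wstar_min) => v v'.
  exact: mean_grad_dotp_le f_smooth grad_mean _ _.
move=> alpha E eta T w.
have E4 : 4 <= E.
  by rewrite /E /alpha ler_pdivlMr//; lra.
have s_gt0 t : 0 < t%:R + E by rewrite ltr_wpDl// (lt_le_trans _ E4).
have eta0 : eta 0%N = 1 / (2 * L).
  by rewrite /eta /E /alpha add0r; field; rewrite !gt_eqF.
have eta_le t : eta t <= eta 0%N.
  rewrite /eta ler_pM2l ?lef_pV2 ?posrE ?mulr_gt0// ler_pM2l// add0r.
  by rewrite lerDr.
have eta_ge0 t : 0 <= eta t by rewrite divr_ge0// mulr_ge0// ltW.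
split => // t tT.
(* A real sequence that satisfies the one-step bound with equality; it dominates the extended-real
   expectations and carries the recursion. *)
pose y t := iteri t (fun s r => (1 - mu * eta s) * r + eta s ^+ 2 * N)
  (enorm (w0 - wstar) ^+ 2).
have Ey s : ('E_P[fun om => (enorm (w s om - wstar) ^+ 2)%R] <= (y s)%:E)%E.
  elim: s => [|s IH].
    by rewrite /w /= expectation_cst.
  have k0 : 0 <= 1 - mu * eta s.
    rewrite subr_ge0 (le_trans (ler_wpM2l (ltW mu_gt0) (eta_le s)))// eta0.
    by rewrite mul1r ler_pdivrMr ?mulr_gt0// mul1r; lra.
  have b0 : 0 <= eta s ^+ 2 * N by rewrite mulr_ge0 ?sqr_ge0// ltW.
  have e1 : 2 * L * eta s <= 1.
    rewrite (le_trans (ler_wpM2l _ (eta_le s)))// ?eta0 ?mulr_ge0// ?(ltW L_gt0)//.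
    by rewrite mul1r divff// gt_eqF// mulr_gt0.
  apply: (le_trans (expectation_sgd_step f_meas f_diff L_gt0 f_smooth w0
    xis_iid k0 b0 _)).
    move=> v; exact: (expectation_sgd_step_le f_meas f_diff L_gt0 f_smooth grad_mean
      v f_convex mu_gt0 F_sc grad0 noise (eta_ge0 s) e1).
  have -> : y s.+1 = (1 - mu * eta s) * y s + eta s ^+ 2 * N by [].
  rewrite [leRHS]EFinD [in leRHS]EFinM; apply: leeD => //.
  exact: lee_wpmul2l.
apply: le_trans (Ey t) _; rewrite lee_fin.
pose M : R := Num.max (L * mu / N * enorm (w0 - wstar) ^+ 2) 1.
have TE : T = E * M - E by rewrite /T /E /alpha; have -> : 2 * 2 * L = 4 * L by ring.
have M1 : 1 <= M by rewrite le_max lexx orbT.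
have c0 : 0 <= 4 * N / mu ^+ 2 by rewrite divr_ge0 ?sqr_ge0// mulr_ge0// ltW.
have y_rec s : y s.+1 <= (1 - 2 / (s%:R + E)) * y s
    + 4 * N / mu ^+ 2 / (s%:R + E) ^+ 2.
  have -> : y s.+1 = (1 - mu * eta s) * y s + eta s ^+ 2 * N by [].
  (* The recursion is an equality here, since mu eta_s = 2 / (s + E). *)
  rewrite /eta /alpha le_eqVlt; apply/orP; left; apply/eqP.
  by field; rewrite !gt_eqF.
have -> : 4 * alpha ^+ 2 * N / mu ^+ 2 * (1 / (t%:R - T + E))
   = 4 * (4 * N / mu ^+ 2) / (t%:R - (E * M - E) + E).
  rewrite TE /alpha mul1r; congr (_ / _); ring.
apply: recursion_rate => //; last by rewrite -TE.
  exact: sqr_ge0.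
rewrite /y /=.
(* The first argument of the maximum in T is exactly the initial squared distance scaled by E / c,
   with c = 4 N / mu^2. *)
have -> : E * enorm (w0 - wstar) ^+ 2 = 4 * N / mu ^+ 2 * (L * mu / N * enorm (w0 - wstar) ^+ 2).
  by rewrite /E /alpha; field; rewrite !gt_eqF.
by rewrite ler_wpM2l// le_max lexx.
Qed.
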